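(* Let $\delta:\mathcal B\to\{\pm1\}$ be a decoration and let $b\in\mathcal B$. Every Peirce eigenspace $A_\lambda=\ker(L_\delta(c_b^\delta)-\lambda\operatorname{Id})$ of $c_b^\delta$ is homogeneous for the grading $\mathbb A^\delta(G_2(m))=\mathbb A_+(b)\oplus\mathbb A_-(b)$ if and only if $b\in\operatorname{Ax}(\delta)$, i.e. $n^\delta_{-1}(b)=m-3$. In that case $$\mathbb A_+(b)=A_1\oplus A_{-1/2}\oplus A_0,\qquad \mathbb A_-(b)=A_{-1}\oplus A_{1/2},$$ and $\theta_b$ is the sign map of this decomposition (that is, $\theta_b=+1$ on $\mathbb A_+(b)$ and $-1$ on $\mathbb A_-(b)$).
   Context: Let $K$ be a field of characteristic $0$, $m\ge3$ and $\Omega=\{1,\dots,m\}$. The Grassmannian geometry $G_2(m)$ has point set $\mathcal P=\binom{\Omega}{2}$ (the point $\{i,j\}$ is written $ij$) and block set $\mathcal B$ consisting of the triples $b_{ijk}=\{ij,ik,jk\}$, one for each $3$-subset $\{i,j,k\}\subseteq\Omega$; $\operatorname{supp}(b_{ijk})=\{i,j,k\}$. For a decoration $\delta:\mathcal B\to\{\pm1\}$, $\mathbb A^\delta(G_2(m))$ is the commutative (nonassociative) $K$-algebra with basis $\{e_p:p\in\mathcal P\}$ and bilinear product $e_{ij}\circ_\delta e_{ik}=\delta(b_{ijk})e_{jk}$ for distinct $i,j,k\in\Omega$, and $e_p\circ_\delta e_q=0$ if $p=q$ or $p\cap q=\varnothing$. The block idempotent of $b$ is $c_b^\delta=\tfrac12\delta(b)\sum_{p\in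 b}e_p$, and $L_\delta(c):x\mapsto c\circ_\delta x$. For a block $b$ the map $\theta_b(e_p)=(-1)^{|p\cap\operatorname{supp}(b)|}e_p$ is an involutive automorphism, and $\mathbb A_{+}(b)$, $\mathbb A_-(b)$ denote its $+1$ and $-1$ eigenspaces: $\mathbb A_+(b)=\operatorname{span}\{e_p:|p\cap\operatorname{supp}(b)|\in\{0,2\}\}$, $\mathbb A_-(b)=\operatorname{span}\{e_p:|p\cap\operatorname{supp}(b)|=1\}$. A subspace is called homogeneous if it is contained in $\mathbb A_+(b)$ or in $\mathbb A_-(b)$. For $\{i,j,k\}=\operatorname{supp}(b)$ and $r\in\Omega\setminus\{i,j,k\}$ put $\kappa_{ijkr}=\delta(b_{ijk})\delta(b_{ijr})\delta(b_{ikr})\delta(b_{jkr})$, let $n^\delta_{-1}(b)=|\{r\in\Omega\setminus\{i,j,k\}:\kappa_{ijkr}=-1\}|$, and $\operatorname{Ax}(\delta)=\{b\in\mathcal B: n^\delta_{-1}(b)=m-3\}$. *)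

(* Defs.v *)
From HB Require Import structures.
From mathcomp Require Import all_boot all_order all_algebra.

Set Implicit Arguments.
Unset Strict Implicit.
Unset Printing Implicit Defensive.

Import GRing.Theory.
Local Open Scope ring_scope.

(* {1, ..., m} is rendered as 'I_m; points and blocks of G_2(m) are subtypes, a
   block being literally a set of points. *)

Definition point (m : nat) := {p : {set 'I_m} | #|p| == 2}.

Definition points_in (m : nat) (T : {set 'I_m}) : {set point m} :=
  [set p : point m | val p \subset T].

Definition block (m : nat) :=
  {b : {set point m} |
    [exists T : {set 'I_m}, (#|T| == 3) && (b == points_in T)]}.

Definition supp (m : nat) (b : block m) : {set 'I_m} :=
  \bigcup_(p in val b) val p.

Record decoration (m : nat) := Decoration {
  dsign :> block m -> int;
  dsignP : forall b, dsign b = 1 \/ dsign b = -1 }.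

Lemma pt_subproof (m : nat) (i j : 'I_m) : i != j -> #|[set i; j]| == 2.
Proof. by rewrite cards2 => ->. Qed.

(* the point ij *)
Definition pt (m : nat) (i j : 'I_m) (ne_ij : i != j) : point m :=
  exist _ [set i; j] (pt_subproof ne_ij).

Lemma card_triple (T : finType) (i j k : T) :
  uniq [:: i; j; k] -> #|[set i; j; k]| = 3.
Proof.
move=> u; rewrite -[RHS]/(size [:: i; j; k]) -(card_uniqP u).
by apply: eq_card => x; rewrite !inE orbA.
Qed.

Lemma blk_subproof (m : nat) (i j k : 'I_m) : uniq [:: i; j; k] ->
  [exists T : {set 'I_m}, (#|T| == 3) && (points_in [set i; j; k] == points_in T)].
Proof.
by move=> u; apply/existsP; exists [set i; j; k]; rewrite card_triple ?eqxx.
Qed.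

(* the block b_ijk *)
Definition blk (m : nat) (i j k : 'I_m) (u : uniq [:: i; j; k]) : block m :=
  exist _ (points_in [set i; j; k]) (blk_subproof u).

Lemma points_in_triple (m : nat) (i j k : 'I_m) (ne_ij : i != j)
    (ne_ik : i != k) (ne_jk : j != k) :
  points_in [set i; j; k] = [set pt ne_ij; pt ne_ik; pt ne_jk].
Proof.
apply/setP => p; rewrite in_set !in_setU !in_set1.
apply/idP/idP; last first.
  by case/orP=> [/orP[]|] /eqP/(congr1 val) /= ->; apply/subsetP => x; rewrite !inE;
     case/orP=> /eqP ->; rewrite eqxx ?orbT.
rewrite -!val_eqE; case: p => p /= /cards2P[x [y [ne_xy ->]]].
rewrite subUset !sub1set !inE => /andP[].
by case/orP=> [/orP[]|] /eqP ex; case/orP=> [/orP[]|] /eqP ey;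
   move: ne_xy; rewrite ex ey ?eqxx // => _; rewrite ?(setUC [set j] [set i])
   ?(setUC [set k] [set i]) ?(setUC [set k] [set j]) ?eqxx ?orbT.
Qed.

Lemma supp_points_in (m : nat) (T : {set 'I_m}) :
  #|T| = 3 -> \bigcup_(p in points_in T) val p = T.
Proof.
move=> T3; apply/eqP; rewrite eqEsubset; apply/andP; split.
  by apply/bigcupsP => p; rewrite [_ \in _]inE.
apply/subsetP => x xT; have : (0 < #|T :\ x|)%N.
  by move: T3; rewrite (cardsD1 x) xT add1n => -[->].
case/card_gt0P => y; rewrite !inE => /andP[ne_yx yT].
have ne_xy : x != y by rewrite eq_sym.
apply/bigcupP; exists (pt ne_xy); last by rewrite !inE eqxx.
by rewrite inE subUset !sub1set xT.
Qed.

Lemma supp_blk (m : nat) (i j k : 'I_m) (u : uniq [:: i; j; k]) :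
  supp (blk u) = [set i; j; k].
Proof. by rewrite /supp supp_points_in ?card_triple. Qed.

Lemma block_supp (m : nat) (b : block m) :
  #|supp b| = 3 /\ val b = points_in (supp b).
Proof.
case: b => b /= bP; have /existsP[T /andP[/eqP T3 /eqP eb]] := bP.
by rewrite /supp /= eb supp_points_in.
Qed.

Lemma supp_inj (m : nat) : injective (@supp m).
Proof.
by move=> b b' e; apply: val_inj; rewrite (block_supp b).2 e -(block_supp b').2.
Qed.

Lemma block_blk (m : nat) (b : block m) :
  exists i j k (u : uniq [:: i; j; k]), b = blk u.
Proof.
have [s3 _] := block_supp b.
have := enum_uniq (supp b); have : size (enum (supp b)) = 3 by rewrite -cardE.
case e : (enum _) => [|i [|j [|k [|? ?]]]] //= _ u.
exists i, j, k, u; apply: supp_inj; rewrite supp_blk.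
by apply/setP => x; rewrite -mem_enum e !inE orbA.
Qed.

(* The algebra A^delta(G_2(m)): its underlying vector space does not depend on
   delta. *)

Definition alg (K : fieldType) (m : nat) := {ffun point m -> K^o}.
HB.instance Definition _ (K : fieldType) (m : nat) := Vector.on (alg K m).

Definition ebase (K : fieldType) (m : nat) (p : point m) : alg K m :=
  [ffun q => (q == p)%:R].
Arguments ebase K {m} p.

(* The product e_p o e_q of two basis vectors.  A block has exactly three
   points, so [val b == [set p; q; r]] forces p, q, r to be distinct, and at
   most one pair (b, r) contributes; see [mul_ebase] and [mul_ebase0]. *)
Definition bprod (K : fieldType) (m : nat) (delta : decoration m)
    (p q : point m) : alg K m :=
  \sum_(b : block m) \sum_(r : point m | val b == [set p; q; r])
     (delta b)%:~R *: ebase K r.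

Definition mul (K : fieldType) (m : nat) (delta : decoration m)
    (x y : alg K m) : alg K m :=
  \sum_(p : point m) \sum_(q : point m)
     (x p * y q : K) *: bprod K delta p q.

Lemma mul_ebaseE (K : fieldType) (m : nat) (delta : decoration m)
  (p q : point m) : mul delta (ebase K p) (ebase K q) = bprod K delta p q.
Proof.
rewrite /mul (bigD1 p) //= (bigD1 q) //= !ffunE !eqxx mulr1 scale1r.
rewrite [X in _ + X + _]big1 => [|q' ne]; last first.
  by rewrite !ffunE (negPf ne) mulr0 scale0r.
rewrite big1 ?addr0 // => p' ne.
by apply: big1 => q' _; rewrite !ffunE (negPf ne) mul0r scale0r.
Qed.

Lemma mul_ebase (K : fieldType) (m : nat) (delta : decoration m)
    (i j k : 'I_m) (u : uniq [:: i; j; k])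
    (ne_ij : i != j) (ne_ik : i != k) (ne_jk : j != k) :
  mul delta (ebase K (pt ne_ij)) (ebase K (pt ne_ik)) =
    (delta (blk u))%:~R *: ebase K (pt ne_jk).
Proof.
rewrite mul_ebaseE /bprod.
have ptsE := points_in_triple ne_ij ne_ik ne_jk.
have key (b : block m) (r : point m) :
    (val b == [set pt ne_ij; pt ne_ik; r]) = (b == blk u) && (r == pt ne_jk).
  apply/eqP/andP => [eb|[/eqP-> /eqP->]]; last exact: ptsE.
  have eb' : b = blk u.
    apply: supp_inj; rewrite supp_blk; apply/esym/eqP; rewrite eqEcard.
    rewrite (block_supp b).1 card_triple // andbT.
    have ij_b : pt ne_ij \in val b by rewrite eb !inE eqxx.
    have ik_b : pt ne_ik \in val b by rewrite eb !inE eqxx orbT.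
    have /= := bigcup_sup (pt ne_ij) ij_b (F := val).
    have /= := bigcup_sup (pt ne_ik) ik_b (F := val).
    rewrite -/(supp b) !subUset !sub1set.
    by case/andP=> -> -> /andP[_ ->].
  split; first exact/eqP.
  have : pt ne_jk \in val b by rewrite eb' /= ptsE !inE eqxx !orbT.
  rewrite eb !inE => /orP[/orP[]|]; last by rewrite eq_sym.
    move/eqP => e; have /setP/(_ i) := congr1 val e; rewrite !inE eqxx (negPf ne_ij) (negPf ne_ik) //.
  by move/eqP => e; have /setP/(_ i) := congr1 val e; rewrite !inE eqxx (negPf ne_ij) (negPf ne_ik).
rewrite (bigD1 (blk u)) //= (big_pred1 (pt ne_jk)) => [|r]; last first.
  by rewrite -[points_in _]/(val (blk u)) key eqxx.
rewrite big1 ?addr0 // => b ne_b; apply: big_pred0 => r.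
by rewrite key (negPf ne_b).
Qed.

Lemma mul_ebase0 (K : fieldType) (m : nat) (delta : decoration m)
    (p q : point m) : p = q \/ val p :&: val q = set0 ->
  mul delta (ebase K p) (ebase K q) = 0.
Proof.
move=> pq; rewrite mul_ebaseE /bprod big1 // => b _; apply: big_pred0 => r.
apply/negbTE/negP => /eqP eb; case: pq => [epq|pq0].
  have [i [j [k [u eb']]]] := block_blk b.
  have [ne_ij ne_ik ne_jk] : [/\ i != j, i != k & j != k].
    by move: u {eb'}; rewrite /= !inE negb_or andbT => /andP[/andP[-> ->] ->].
  have : #|val b| = 3.
    rewrite eb' /= (points_in_triple ne_ij ne_ik ne_jk) card_triple //=.
    rewrite !inE andbT negb_or; apply/andP; split; last first.
      by apply/eqP => /(congr1 val)/setP/(_ i); rewrite !inE eqxx (negPf ne_ij) (negPf ne_ik).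
    apply/andP; split.
      by apply/eqP => /(congr1 val)/setP/(_ j); rewrite !inE eqxx orbT (negPf ne_jk)
         eq_sym (negPf ne_ij).
    by apply/eqP => /(congr1 val)/setP/(_ i); rewrite !inE eqxx (negPf ne_ij) (negPf ne_ik).
  by rewrite eb epq setUid cards2; case: (_ != _).
have [s3 _] := block_supp b.
have p_b : p \in val b by rewrite eb !inE eqxx.
have q_b : q \in val b by rewrite eb !inE eqxx orbT.
have : val p :|: val q \subset supp b.
  by rewrite subUset (bigcup_sup p) // (bigcup_sup q).
move/subset_leq_card; rewrite s3 cardsU pq0 cards0 subn0.
by rewrite (eqP (valP p)) (eqP (valP q)).
Qed.

Lemma mul_is_linear (K : fieldType) (m : nat) (delta : decoration m)
  (x : alg K m) : linear (mul delta x).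
Proof.
move=> a u v; rewrite /mul scaler_sumr -big_split; apply: eq_bigr => p _ /=.
rewrite scaler_sumr -big_split; apply: eq_bigr => q _ /=.
by rewrite !ffunE mulrDr scalerDl scalerA mulrCA.
Qed.

HB.instance Definition _ (K : fieldType) (m : nat) (delta : decoration m)
    (x : alg K m) :=
  GRing.isLinear.Build K (alg K m) (alg K m) *:%R (mul delta x)
    (mul_is_linear delta x).

Definition Lmul (K : fieldType) (m : nat) (delta : decoration m)
    (c : alg K m) : 'End(alg K m) := linfun (mul delta c).

Definition idem (K : fieldType) (m : nat) (delta : decoration m)
    (b : block m) : alg K m :=
  (2%:R^-1 * (delta b)%:~R) *: \sum_(p in val b) ebase K p.
Arguments idem K {m} delta b.

Definition peirce (K : fieldType) (m : nat) (delta : decoration m)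
    (b : block m) (a : K) : {vspace alg K m} :=
  lker (Lmul delta (idem K delta b) - a *: \1%VF).

Definition theta_fun (K : fieldType) (m : nat) (b : block m) (x : alg K m) :
  alg K m := \sum_(p : point m) (x p : K) *:
     ((-1) ^+ #|val p :&: supp b| *: ebase K p).

Lemma theta_is_linear (K : fieldType) (m : nat) (b : block m) :
  linear (@theta_fun K m b).
Proof.
move=> a u v; rewrite /theta_fun scaler_sumr -big_split.
by apply: eq_bigr => p _; rewrite /= !ffunE scalerDl -scalerA.
Qed.

HB.instance Definition _ (K : fieldType) (m : nat) (b : block m) :=
  GRing.isLinear.Build K (alg K m) (alg K m) *:%R (@theta_fun K m b)
    (theta_is_linear b).

Definition theta (K : fieldType) (m : nat) (b : block m) : 'End(alg K m) :=
  linfun (@theta_fun K m b).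
Arguments theta K {m} b.

Definition Aplus (K : fieldType) (m : nat) (b : block m) : {vspace alg K m} :=
  span [seq ebase K p |
      p in [set p : point m | #|val p :&: supp b| \in [:: 0; 2]%N]].
Arguments Aplus K {m} b.

Definition Aminus (K : fieldType) (m : nat) (b : block m) : {vspace alg K m} :=
  span [seq ebase K p |
      p in [set p : point m | #|val p :&: supp b| == 1%N]].
Arguments Aminus K {m} b.

Definition homogeneous (K : fieldType) (m : nat) (b : block m)
    (U : {vspace alg K m}) : bool :=
  (U <= Aplus K b)%VS || (U <= Aminus K b)%VS.

(* kappa_ijkr, with {i, j, k} = supp b: the product of the signs of the four
   blocks on {i, j, k, r}; see [kappaE]. *)
Definition kappa (m : nat) (delta : decoration m) (b : block m) (r : 'I_m) :
  int := \prod_(b' : block m | supp b' \subset r |: supp b) delta b'.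

Definition n_neg (m : nat) (delta : decoration m) (b : block m) : nat :=
  #|[set r : 'I_m | (r \notin supp b) && (kappa delta b r == -1)]|.

Definition Ax (m : nat) (delta : decoration m) : {set block m} :=
  [set b | n_neg delta b == (m - 3)%N].

Lemma kappaE (m : nat) (delta : decoration m) (i j k r : 'I_m)
    (u_ijk : uniq [:: i; j; k]) (u_ijr : uniq [:: i; j; r])
    (u_ikr : uniq [:: i; k; r]) (u_jkr : uniq [:: j; k; r]) :
  kappa delta (blk u_ijk) r = delta (blk u_ijk) * delta (blk u_ijr) *
    delta (blk u_ikr) * delta (blk u_jkr).
Proof.
have [ne_ij ne_ik ne_jk] : [/\ i != j, i != k & j != k].
  by move: u_ijk; rewrite /= !inE negb_or andbT => /andP[/andP[-> ->] ->].
have [ne_ir ne_jr] : i != r /\ j != r.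
  by move: u_ijr; rewrite /= !inE negb_or andbT => /andP[/andP[_ ->] ->].
have ne_kr : k != r.
  by move: u_ikr; rewrite /= !inE negb_or andbT => /andP[_ ->].
pose s := [:: blk u_ijk; blk u_ijr; blk u_ikr; blk u_jkr].
have neq (b b' : block m) x : x \in supp b -> x \notin supp b' -> b != b'.
  by move=> xb xb'; apply: contraNneq xb' => <-.
have us : uniq s.
  rewrite /= !inE !negb_or !andbT -!andbA; apply/and5P; split.
  - by apply: (neq _ _ k); rewrite supp_blk !inE ?eqxx ?orbT //
       ![k == _]eq_sym (negPf ne_ik) (negPf ne_jk) eq_sym (negPf ne_kr).
  - by apply: (neq _ _ j); rewrite supp_blk !inE ?eqxx ?orbT //
       [j == i]eq_sym (negPf ne_ij) (negPf ne_jk) (negPf ne_jr).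
  - by apply: (neq _ _ i); rewrite supp_blk !inE ?eqxx ?orbT //
       (negPf ne_ij) (negPf ne_ik) (negPf ne_ir).
  - by apply: (neq _ _ j); rewrite supp_blk !inE ?eqxx ?orbT //
       [j == i]eq_sym (negPf ne_ij) (negPf ne_jk) (negPf ne_jr).
  by apply/andP; split; apply: (neq _ _ i); rewrite supp_blk !inE ?eqxx ?orbT //
       (negPf ne_ij) ?(negPf ne_ik) ?(negPf ne_jk) (negPf ne_ir).
rewrite /kappa (eq_bigl (mem s)) => [|b]; last first.
  rewrite supp_blk; set U := r |: _; have U4 : #|U| = 4.
    rewrite cardsU1 card_triple // !inE ![r == _]eq_sym.
    by rewrite (negPf ne_ir) (negPf ne_jr) (negPf ne_kr).
  rewrite inE; apply/idP/idP => [bU|]; last first.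
    by rewrite !inE => /or4P[]/eqP->; rewrite supp_blk !subUset !sub1set !inE
      ?eqxx ?orbT.
  have [s3 _] := block_supp b.
  have : #|U :\: supp b| == 1%N by rewrite cardsD (setIidPr bU) U4 s3.
  case/cards1P=> x ex.
  have sE y : (y \in supp b) = (y \in U) && (y != x).
    have := congr1 (fun A : {set _} => y \in A) ex; rewrite !inE.
    have := subsetP bU y; rewrite !inE.
    by case: (y \in supp b) => [->|_] //= <-; rewrite ?andbN.
  have : x \in U by have := set11 x; rewrite -ex !inE => /andP[].
  rewrite !inE => /orP[|/orP[/orP[]|]] /eqP xE; subst x.
  - apply/or4P; constructor 1; apply/eqP/supp_inj/setP => y; rewrite supp_blk sE !inE.
    by case: (y =P r) => [->|]; rewrite ?andbT // ![r == _]eq_sym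
      (negPf ne_ir) (negPf ne_jr) (negPf ne_kr).
  - apply/or4P; constructor 4; apply/eqP/supp_inj/setP => y; rewrite supp_blk sE !inE.
    case: (y =P i) => [->|]; rewrite ?andbT ?andbF ?(negPf ne_ij)
      ?(negPf ne_ik) ?(negPf ne_ir) //.
    by rewrite orbC.
  - apply/or4P; constructor 3; apply/eqP/supp_inj/setP => y; rewrite supp_blk sE !inE.
    case: (y =P j) => [->|]; rewrite ?andbT ?andbF ?[j == i]eq_sym ?(negPf ne_ij)
      ?(negPf ne_jk) ?(negPf ne_jr) //.
    by rewrite orbF orbC.
  apply/or4P; constructor 2; apply/eqP/supp_inj/setP => y; rewrite supp_blk sE !inE.
  case: (y =P k) => [->|]; rewrite ?andbT ?andbF ?[k == i]eq_sym ?[k == j]eq_sym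
    ?(negPf ne_ik) ?(negPf ne_jk) ?(negPf ne_kr) //.
  by rewrite orbF orbC.
by rewrite -big_uniq //= !big_cons big_nil mulr1 !mulrA.
Qed.

(* Main.v *)
(** Write [L] for the multiplication by the idempotent of [b].  [L] kills the
    points disjoint from [supp b]; it preserves the span of the three points of
    [b], and, for each [r] outside [supp b], the span of the three points [ir]
    with [i] in [supp b].  On each of these 3-spaces [2 L] is a signed adjacency
    matrix of a triangle whose product of signs is [s], with [s = 1] for [b] and
    [s = kappa delta b r] for [r]; hence [(L - s) (L + s / 2) = 0] there.  If all
    [kappa] are [-1], the eigenvalues [1], [-1/2], [0] on the even part and
    [-1], [1/2] on the odd part are distinct, so the eigenspaces are
    homogeneous.  If some [kappa] is [1], the eigenvalue [1] occurs in both
    degrees. *)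
Require Import Defs.
From mathcomp Require Import all_boot all_order all_algebra.
From mathcomp Require Import ring.

Set Implicit Arguments.
Unset Strict Implicit.
Unset Printing Implicit Defensive.

Import GRing.Theory.
Local Open Scope ring_scope.

Section Peirce.

Variables (K : fieldType) (m : nat) (delta : decoration m).
Implicit Types (i j k r : 'I_m) (p q : point m) (x y z : alg K m).

(** * Coordinates, commutativity and bilinearity of the product *)

Lemma alg_addE x y p : (x + y) p = x p + y p.
Proof. exact: ffunE. Qed.

Lemma alg_oppE x p : (- x) p = - x p.
Proof. exact: ffunE. Qed.

Lemma alg_scaleE (a : K) x p : (a *: x) p = a * x p :> K.
Proof. exact: ffunE. Qed.

Let algE := (alg_addE, alg_oppE, alg_scaleE).

Lemma bprodC p q : bprod K delta p q = bprod K delta q p.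
Proof. by apply: eq_bigr => b _; apply: eq_bigl => r; rewrite (setUC [set p]). Qed.

Lemma mulC x y : Defs.mul delta x y = Defs.mul delta y x.
Proof.
rewrite /Defs.mul exchange_big; apply: eq_bigr => p _; apply: eq_bigr => q _.
by rewrite bprodC mulrC.
Qed.

(** Linearity is registered in the second argument; commutativity carries it over to the first. *)
Lemma mulDl x y z : Defs.mul delta (x + y) z = Defs.mul delta x z + Defs.mul delta y z.
Proof. by rewrite !(mulC _ z) linearD. Qed.

Lemma mulZl a x z : Defs.mul delta (a *: x) z = a *: Defs.mul delta x z.
Proof. by rewrite !(mulC _ z) linearZ. Qed.

(** * Basis vectors and block signs indexed by elements of ['I_m] *)

(* Total in [i] and [j], hence symmetric; the junk value at [i = j] is [0]. *)
Definition edge i j : alg K m := \sum_(p | val p == [set i; j]) ebase K p.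

(* Likewise [0] unless [i], [j], [k] are distinct. *)
Definition bsign i j k : K :=
  \sum_(b : block m | supp b == [set i; j; k]) (delta b)%:~R.

Lemma edgeC i j : edge i j = edge j i.
Proof. by apply: eq_bigl => p; rewrite setUC. Qed.

Lemma edge_ebase p i j : val p = [set i; j] -> edge i j = ebase K p.
Proof. by move=> e; apply: big_pred1 => q; rewrite -e. Qed.

Lemma edge_pt i j (ne : i != j) : edge i j = ebase K (pt ne).
Proof. exact: edge_ebase. Qed.

Lemma bsign12 i j k : bsign i j k = bsign j i k.
Proof. by apply: eq_bigl => b; rewrite (setUC [set i]). Qed.

Lemma bsign23 i j k : bsign i j k = bsign i k j.
Proof. by apply: eq_bigl => b; rewrite setUAC. Qed.

Lemma bsign_supp (b : block m) i j k :
  supp b = [set i; j; k] -> bsign i j k = (delta b)%:~R.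
Proof. by move=> e; apply: big_pred1 => b'; rewrite -e (inj_eq (@supp_inj m)). Qed.

Lemma bsign_blk i j k (u : uniq [:: i; j; k]) :
  bsign i j k = (delta (blk u))%:~R.
Proof. exact/bsign_supp/supp_blk. Qed.

Lemma bsign_cases i j k : uniq [:: i; j; k] -> bsign i j k = 1 \/ bsign i j k = -1.
Proof.
move=> u; rewrite (bsign_blk u).
by case: (dsignP delta (blk u)) => ->; [left|right]; rewrite ?intrN.
Qed.

Lemma uniq3P i j k : uniq [:: i; j; k] -> [/\ i != j, i != k & j != k].
Proof. by rewrite /= !inE negb_or andbT => /andP[/andP[-> ->] ->]. Qed.

Lemma mul_edge i j k : uniq [:: i; j; k] ->
  Defs.mul delta (edge i j) (edge i k) = bsign i j k *: edge j k.
Proof.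
move=> u; have [ij ik jk] := uniq3P u.
by rewrite (edge_pt ij) (edge_pt ik) (edge_pt jk) (bsign_blk u) -mul_ebase.
Qed.

Lemma mul_edgexx i j : i != j -> Defs.mul delta (edge i j) (edge i j) = 0.
Proof. by move=> ij; rewrite (edge_pt ij) mul_ebase0 //; left. Qed.

Lemma mul_edge0 i j p : i != j -> i \notin val p -> j \notin val p ->
  Defs.mul delta (edge i j) (ebase K p) = 0.
Proof.
move=> ij ip jp; rewrite (edge_pt ij) mul_ebase0 //; right.
apply/setP => x; rewrite !inE; apply/negP => /andP[/orP[] /eqP->].
  by rewrite (negPf ip).
by rewrite (negPf jp).
Qed.

(** * Action of the block idempotent on basis vectors *)

Variable b : block m.

Let L := Lmul delta (idem K delta b).

Lemma idemE i j k : uniq [:: i; j; k] -> supp b = [set i; j; k] ->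
  idem K delta b =
    (2%:R^-1 * bsign i j k) *: (edge i j + edge i k + edge j k).
Proof.
move=> u sb; have [ij ik jk] := uniq3P u.
rewrite /idem (bsign_supp sb); congr (_ *: _).
rewrite (block_supp b).2 sb (points_in_triple ij ik jk) -setUA.
rewrite (edge_pt ij) (edge_pt ik) (edge_pt jk) !big_setU1 ?big_set1 /=.
- by rewrite addrA.
- by rewrite !inE; apply/eqP => /(congr1 val)/setP/(_ i);
    rewrite !inE eqxx (negPf ij) (negPf ik).
rewrite !inE; apply/norP; split; apply/eqP => /(congr1 val)/setP.
  by move/(_ j); rewrite !inE eqxx orbT eq_sym (negPf ij) (negPf jk).
by move/(_ i); rewrite !inE eqxx (negPf ij) (negPf ik).
Qed.

Lemma L_mul x : L x = Defs.mul delta (idem K delta b) x.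
Proof. by rewrite /L /Lmul lfunE. Qed.

(** Of the three points of [b], [ij] and [ik] meet [ir] in [i] and send it to [jr] and [kr]; [jk] is
    disjoint from [ir]. *)
Lemma L_mixed i j k r : uniq [:: i; j; k; r] -> supp b = [set i; j; k] ->
  L (edge i r) = (2%:R^-1 * bsign i j k) *:
    (bsign i j r *: edge j r + bsign i k r *: edge k r).
Proof.
move=> /= /and4P[]; rewrite !inE !negb_or => /and3P[ij ik ir] /andP[jk jr] kr _ sb.
have uijk : uniq [:: i; j; k] by rewrite /= !inE negb_or ij ik jk.
have uijr : uniq [:: i; j; r] by rewrite /= !inE negb_or ij ir jr.
have uikr : uniq [:: i; k; r] by rewrite /= !inE negb_or ik ir kr.
rewrite L_mul (idemE uijk sb) mulZl !mulDl !mul_edge //.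
rewrite (edge_pt ir) mul_edge0 ?addr0 //= !inE negb_or.
  by rewrite jr eq_sym ij.
by rewrite kr eq_sym ik.
Qed.

(** Both nonzero products carry the sign of [b], which cancels against the sign in the
    idempotent. *)
Lemma L_block i j k : uniq [:: i; j; k] -> supp b = [set i; j; k] ->
  L (edge i j) = 2%:R^-1 *: (edge i k + edge j k).
Proof.
move=> u sb; have [ij ik jk] := uniq3P u.
have uikj : uniq [:: i; k; j].
  by rewrite /= !inE negb_or ij ik eq_sym jk.
have ujki : uniq [:: j; k; i].
  by rewrite /= !inE negb_or jk ![_ == i]eq_sym ij ik.
rewrite L_mul (idemE u sb) mulZl !mulDl mul_edgexx // add0r mul_edge //.
rewrite (edgeC i j) mul_edge // -(bsign23 i j k).
rewrite (bsign23 j k i) (bsign12 j i k) -scalerDr scalerA -mulrA.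
rewrite (edgeC k j) (edgeC k i) addrC.
suff -> : bsign i j k * bsign i j k = 1 by rewrite mulr1.
by case: (bsign_cases u) => ->; rewrite ?mulrNN mulr1.
Qed.

Lemma L_disjoint p : #|val p :&: supp b| = 0%N -> L (ebase K p) = 0.
Proof.
move/cards0_eq/setP => pS; have [i [j [k [u bE]]]] := block_blk b.
have sb : supp b = [set i; j; k] by rewrite bE supp_blk.
have [ij ik jk] := uniq3P u.
have notp l : l \in [set i; j; k] -> l \notin val p.
  by move=> lS; have := pS l; rewrite sb inE lS andbT inE => ->.
by rewrite L_mul (idemE u sb) mulZl !mulDl !mul_edge0 ?addr0 ?scaler0 // notp //;
  rewrite !inE eqxx ?orbT.
Qed.

(** * The signs [kappa] in the field *)

Lemma kappa_cases r : kappa delta b r = 1 \/ kappa delta b r = -1.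
Proof.
rewrite /kappa; apply: (big_ind (fun z : int => z = 1 \/ z = -1)).
- by left.
- by move=> x y [] -> [] ->; rewrite ?mulrNN ?mulr1 ?mul1r; auto.
- by move=> b' _; apply: dsignP.
Qed.

Lemma kappa_bsign i j k r : uniq [:: i; j; k; r] -> supp b = [set i; j; k] ->
  (kappa delta b r)%:~R =
    bsign i j k * bsign i j r * bsign i k r * bsign j k r.
Proof.
move=> /= /and4P[]; rewrite !inE !negb_or => /and3P[ij ik ir] /andP[jk jr] kr _ sb.
have uijk : uniq [:: i; j; k] by rewrite /= !inE negb_or ij ik jk.
have uijr : uniq [:: i; j; r] by rewrite /= !inE negb_or ij ir jr.
have uikr : uniq [:: i; k; r] by rewrite /= !inE negb_or ik ir kr.
have ujkr : uniq [:: j; k; r] by rewrite /= !inE negb_or jk jr kr.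
have -> : b = blk uijk by apply: supp_inj; rewrite supp_blk.
by rewrite (kappaE delta uijk uijr uikr ujkr) !rmorphM /= !bsign_blk.
Qed.

Lemma edgeE p i j : i != j -> edge i j p = (val p == [set i; j])%:R.
Proof. by move=> ij; rewrite (edge_pt ij) ffunE -val_eqE. Qed.

(** * The quadratic relation satisfied by [L] *)

Hypothesis two_neq0 : 2%:R != 0 :> K.

(** On [ir], [jr], [kr] the matrix of [2 L] is symmetric with zero diagonal and signs elsewhere. Its
    square has diagonal 2, and each off-diagonal entry is the product of the other two signs, that
    is, [s] times the entry itself, where [s] is the product of all three. So
    [(2 L)^2 = 2 + s (2 L)], and [s] is [kappa], because the sign of [b] enters three times. *)
Lemma L2_mixed i j k r : uniq [:: i; j; k; r] -> supp b = [set i; j; k] ->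
  L (L (edge i r)) =
    2%:R^-1 *: (edge i r + (kappa delta b r)%:~R *: L (edge i r)).
Proof.
move=> u sb.
have uj : uniq [:: j; i; k; r].
  by move: u; rewrite /= !inE !negb_or (eq_sym j i); case: (i != j); case: (i != k);
    case: (i != r); case: (j != k); case: (j != r).
have uk : uniq [:: k; i; j; r].
  by move: u; rewrite /= !inE !negb_or (eq_sym k i) (eq_sym k j);
    case: (i != j); case: (i != k); case: (i != r); case: (j != k); case: (j != r).
have sj : supp b = [set j; i; k] by rewrite sb (setUC [set i]).
have sk : supp b = [set k; i; j] by rewrite sb setUC setUA.
rewrite (kappa_bsign u sb) (L_mixed u sb) !linearZ linearD !linearZ /=.
rewrite (L_mixed uj sj) (L_mixed uk sk).
have -> : bsign j i k = bsign i j k by rewrite bsign12.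
have -> : bsign k i j = bsign i j k by rewrite bsign12 bsign23.
rewrite (bsign12 j i r) (bsign12 k i r) (bsign12 k j r).
have [uijk uijr uikr ujkr] : [/\ uniq [:: i; j; k], uniq [:: i; j; r],
    uniq [:: i; k; r] & uniq [:: j; k; r]].
  by move: u; rewrite /= !inE !negb_or; case: (i != j); case: (i != k);
    case: (i != r); case: (j != k); case: (j != r); case: (k != r).
(* With the edges replaced by arbitrary vectors, each of the 16 sign patterns leaves a scalar
   identity in every coordinate. *)
move: (edge i r) (edge j r) (edge k r) => x y z.
apply/ffunP => p; rewrite !algE.
by case: (bsign_cases uijk) => ->; case: (bsign_cases uijr) => ->;
  case: (bsign_cases uikr) => ->; case: (bsign_cases ujkr) => ->; field.
Qed.

(** The same computation with all signs equal to 1, hence [s = 1]. *)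
Lemma L2_block i j k : uniq [:: i; j; k] -> supp b = [set i; j; k] ->
  L (L (edge i j)) = 2%:R^-1 *: (edge i j + L (edge i j)).
Proof.
move=> u sb.
have uik : uniq [:: i; k; j].
  by move: u; rewrite /= !inE !negb_or (eq_sym k j); case: (i != j); case: (i != k).
have ujk : uniq [:: j; k; i].
  by move: u; rewrite /= !inE !negb_or (eq_sym j i) (eq_sym k i);
    case: (i != j); case: (i != k); case: (j != k).
have sik : supp b = [set i; k; j] by rewrite sb setUAC.
have sjk : supp b = [set j; k; i] by rewrite sb -setUA setUC.
rewrite (L_block u sb) linearZ linearD /= (L_block uik sik) (L_block ujk sjk).
rewrite (edgeC k j) (edgeC k i) (edgeC j i).
by apply/ffunP => p; rewrite !algE; field.
Qed.

(** * The even and odd parts: stability under [L], the sign map, and the splitting *)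

Lemma mem_Aplus p : #|val p :&: supp b| != 1%N -> ebase K p \in Aplus K b.
Proof.
move=> pb; apply/memv_span/image_f; rewrite !inE.
have := subset_leq_card (subsetIl (val p) (supp b)); rewrite (eqP (valP p)).
by case: #|_| pb => [|[|[|]]].
Qed.

Lemma mem_Aminus p : #|val p :&: supp b| = 1%N -> ebase K p \in Aminus K b.
Proof. by move=> pb; apply/memv_span/image_f; rewrite !inE pb. Qed.

Lemma Aplus_sub (U : {vspace alg K m}) :
    (forall p, #|val p :&: supp b| = 0%N -> ebase K p \in U) ->
    (forall p, #|val p :&: supp b| = 2%N -> ebase K p \in U) ->
  (Aplus K b <= U)%VS.
Proof.
move=> U0 U2; apply/span_subvP => _ /imageP[p pb ->].
by move: pb; rewrite !inE => /orP[] /eqP; [apply: U0|apply: U2].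
Qed.

Lemma Aminus_sub (U : {vspace alg K m}) :
  (forall p, #|val p :&: supp b| = 1%N -> ebase K p \in U) ->
  (Aminus K b <= U)%VS.
Proof.
move=> U1; apply/span_subvP => _ /imageP[p pb ->].
by move: pb; rewrite !inE => /eqP; apply: U1.
Qed.

(** Supplies the labels needed for [L_mixed]: [i] is the common element of [p] and [supp b], and [r]
    is the other element of [p]. *)
Lemma point_mixed p : #|val p :&: supp b| = 1%N -> exists i j k r,
  [/\ uniq [:: i; j; k; r], supp b = [set i; j; k] & val p = [set i; r]].
Proof.
move=> p1; have /cards1P[i pi] : #|val p :&: supp b| == 1%N by rewrite p1.
have /setIP[ip ib] : i \in val p :&: supp b by rewrite pi set11.
have /cards1P[r pr] : #|val p :\ i| == 1%N.
  by have := valP p; rewrite (cardsD1 i) ip.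
have /cards2P[j [k [jk bjk]]] : #|supp b :\ i| == 2%N.
  by have [] := block_supp b; rewrite (cardsD1 i) ib => /eqP.
exists i, j, k, r.
have pE : val p = [set i; r] by rewrite -(setD1K ip) pr.
have bE : supp b = [set i; j; k] by rewrite -(setD1K ib) bjk setUA.
have : i \notin supp b :\ i by rewrite !inE eqxx.
rewrite bjk !inE negb_or => /andP[ij ik].
have : r \in val p :\ i by rewrite pr set11.
rewrite !inE => /andP[ri rp].
have : r \notin supp b.
  apply/negP => rb; have : r \in val p :&: supp b by rewrite inE rp.
  by rewrite pi inE (negPf ri).
rewrite bE !inE !negb_or -andbA => /and3P[_ rj rk].
by split=> //=; rewrite !inE !negb_or ij ik jk !(eq_sym _ r) ri rj rk.
Qed.

Lemma point_block p : #|val p :&: supp b| = 2%N -> exists i j k,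
  [/\ uniq [:: i; j; k], supp b = [set i; j; k] & val p = [set i; j]].
Proof.
move=> p2; have /cards2P[i [j [ij pE]]] := valP p.
have /setIidPl pb : val p :&: supp b = val p.
  by apply/eqP; rewrite eqEcard subsetIl p2 (eqP (valP p)).
have /cards1P[k kE] : #|supp b :\: val p| == 1%N.
  by rewrite cardsD (setIidPr pb) (block_supp b).1 (eqP (valP p)).
have : k \notin val p by have := set11 k; rewrite -kE inE => /andP[].
rewrite pE !inE negb_or => /andP[ki kj].
exists i, j, k; split=> //.
  by rewrite /= !inE negb_or ij !(eq_sym _ k) ki kj.
by rewrite -(setID (supp b) (val p)) (setIidPr pb) kE pE.
Qed.

Lemma edge_Aplus i j : i \in supp b -> j \in supp b -> i != j ->
  edge i j \in Aplus K b.
Proof.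
move=> ib jb ij; rewrite (edge_pt ij) mem_Aplus //=.
by rewrite (setIidPl _) ?cards2 ?ij // subUset !sub1set ib.
Qed.

Lemma edge_Aminus i r : i \in supp b -> r \notin supp b ->
  edge i r \in Aminus K b.
Proof.
move=> ib rb; have ir : i != r by apply: contraNneq rb => <-.
rewrite (edge_pt ir) mem_Aminus //=; apply/eqP/cards1P; exists i.
apply/setP => l; rewrite !inE; case: (l =P i) => [->|_] //=.
by case: (l =P r) => [->|] //=; apply/negbTE.
Qed.

Lemma L_Aplus x : x \in Aplus K b -> L x \in Aplus K b.
Proof.
(* The preimage of a subspace under [L] is a subspace, so testing the spanning basis vectors is
   enough. *)
move=> xA; rewrite memv_preim; apply: (subvP _ _ xA) => {x xA}.
apply: Aplus_sub => p pb; rewrite -memv_preim.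
  by rewrite L_disjoint ?mem0v.
have [i [j [k [u sb pE]]]] := point_block pb; have [ij ik jk] := uniq3P u.
by rewrite -(edge_ebase pE) (L_block u sb) memvZ ?memvD // edge_Aplus // sb
  !inE eqxx ?orbT.
Qed.

Lemma L_Aminus x : x \in Aminus K b -> L x \in Aminus K b.
Proof.
move=> xA; rewrite memv_preim; apply: (subvP _ _ xA) => {x xA}.
apply: Aminus_sub => p pb; rewrite -memv_preim.
have [i [j [k [r [u sb pE]]]]] := point_mixed pb.
have rb : r \notin supp b.
  move: u; rewrite sb /= !inE !negb_or !(eq_sym r).
  by move=> /and4P[/and3P[_ _ ->] /andP[_ ->] ->].
by rewrite -(edge_ebase pE) (L_mixed u sb) memvZ ?memvD ?memvZ ?edge_Aminus //
  sb !inE eqxx ?orbT.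
Qed.

Lemma theta_ebase p :
  theta K b (ebase K p) = (-1) ^+ #|val p :&: supp b| *: ebase K p.
Proof.
rewrite lfunE /= /theta_fun (bigD1 p) //= big1 ?addr0 => [|q qp].
  by rewrite ffunE eqxx scale1r.
by rewrite ffunE (negPf qp) scale0r.
Qed.

Lemma theta_Aplus x : x \in Aplus K b -> theta K b x = x.
Proof.
(* The fixed vectors form a kernel, which again reduces the claim to basis vectors. *)
move=> xA; suff: x \in lker (theta K b - \1%VF).
  by rewrite memv_ker add_lfunE opp_lfunE id_lfunE subr_eq0 => /eqP.
apply: (subvP _ _ xA) => {x xA}; apply: Aplus_sub => p pb;
  by rewrite memv_ker add_lfunE opp_lfunE id_lfunE theta_ebase pb
    ?expr0 ?sqrrN ?expr1n scale1r subrr.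
Qed.

Lemma theta_Aminus x : x \in Aminus K b -> theta K b x = - x.
Proof.
move=> xA; suff: x \in lker (theta K b + \1%VF).
  by rewrite memv_ker add_lfunE id_lfunE addr_eq0 => /eqP.
apply: (subvP _ _ xA) => {x xA}; apply: Aminus_sub => p pb.
by rewrite memv_ker add_lfunE id_lfunE theta_ebase pb expr1 scaleN1r addNr.
Qed.

(** The sign map both fixes and negates [x], so [2 x = 0]. *)
Lemma Aplus_Aminus0 x : x \in Aplus K b -> x \in Aminus K b -> x = 0.
Proof.
move=> /theta_Aplus xp /theta_Aminus; rewrite xp => /eqP.
by rewrite -addr_eq0 -mulr2n -scaler_nat scaler_eq0 (negPf two_neq0) => /eqP.
Qed.

Lemma alg_split x : exists y z,
  [/\ x = y + z, y \in Aplus K b & z \in Aminus K b].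
Proof.
suff /memv_addP[y yA [z zA ->]] : x \in (Aplus K b + Aminus K b)%VS.
  by exists y, z.
have -> : x = \sum_p (x p : K) *: ebase K p.
  apply/ffunP => q; rewrite sum_ffunE (bigD1 q) //= big1 => [|p pq].
    by rewrite !ffunE eqxx addr0 [RHS]mulr1.
  by rewrite !ffunE eq_sym (negPf pq) [LHS]mulr0.
apply: memv_suml => p _; apply: memvZ.
have [/mem_Aminus|/eqP/mem_Aplus] := @eqP _ #|val p :&: supp b| 1%N.
  exact/subvP/addvSr.
exact/subvP/addvSl.
Qed.

(** * Peirce eigenspaces: compatibility with the grading, and independence *)

Local Notation A a := (peirce delta b a).

Lemma mem_peirce a x : (x \in A a) = (L x == a *: x).
Proof. by rewrite /peirce memv_ker add_lfunE opp_lfunE scale_lfunE id_lfunE subr_eq0. Qed.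

(** Both parts are stable under [L], so [(L - a) y = - (L - a) z] lies in their intersection and
    vanishes. *)
Lemma peirce_split a x : x \in A a -> exists y z,
  [/\ x = y + z, y \in Aplus K b, z \in Aminus K b, y \in A a & z \in A a].
Proof.
have [y [z [-> yA zA]]] := alg_split x; rewrite mem_peirce => /eqP Lx.
exists y, z; have Lyz : L y - a *: y = - (L z - a *: z).
  apply/eqP; rewrite -addr_eq0 addrACA -linearD /= Lx -opprD -scalerDr.
  by rewrite subrr.
have y0 : L y - a *: y = 0.
  apply: Aplus_Aminus0; first by rewrite memvB ?memvZ ?L_Aplus.
  by rewrite Lyz memvN memvB ?memvZ ?L_Aminus.
split=> //; rewrite mem_peirce -subr_eq0 ?y0 //.
by rewrite -oppr_eq0 -Lyz y0.
Qed.

(* A vector of [A a] in [A c1 + A c2 + ...] loses one summand at a time. *)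
Lemma peirce_drop (U : {vspace alg K m}) a c x : a != c ->
    (forall u, u \in U -> L u \in U) ->
  x \in A a -> x \in (U + A c)%VS -> x \in U.
Proof.
move=> ac LU xa /memv_addP[u uU [v vc xE]].
move: xa vc; rewrite !mem_peirce => /eqP Lx /eqP Lv.
(* Applying [L - c] to [x] multiplies it by [a - c] and kills the summand [v]. *)
have : (a - c) *: x \in U.
  have -> : (a - c) *: x = L u - c *: u; last by rewrite memvB ?memvZ ?LU.
  by rewrite scalerBl -Lx xE linearD /= Lv scalerDr opprD addrACA subrr addr0.
by rewrite rpredZeq subr_eq0 (negPf ac).
Qed.

Lemma L_peirce a u : u \in A a -> L u \in A a.
Proof. by move=> ua; have := ua; rewrite mem_peirce => /eqP ->; apply: memvZ. Qed.

Lemma L_peirceD a c u : u \in (A a + A c)%VS -> L u \in (A a + A c)%VS.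
Proof.
move=> /memv_addP[v va [w wc ->]].
by rewrite linearD /= memv_add ?L_peirce.
Qed.

Lemma peirce2_eq0 a c d x : a != c -> a != d ->
  x \in A a -> x \in (A c + A d)%VS -> x = 0.
Proof.
move=> ac ad xa xcd.
have xc : x \in A c by apply: (peirce_drop ad _ xa xcd); apply: L_peirce.
apply/eqP; rewrite -memv0; apply: (peirce_drop ac _ xa); last by rewrite add0v.
by move=> u; rewrite !memv0 => /eqP ->; rewrite linear0.
Qed.

Lemma peirce3_eq0 a c d e x : a != c -> a != d -> a != e ->
  x \in A a -> x \in (A c + A d + A e)%VS -> x = 0.
Proof.
move=> ac ad ae xa xcde; apply: (peirce2_eq0 ac ad xa).
by apply: (peirce_drop ae _ xa xcde) => u; apply: L_peirceD.
Qed.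

Lemma directv_peirce2 (a c : K) : a != c -> directv (A a + A c).
Proof.
move=> ac; apply/directv_addP/eqP; rewrite -subv0; apply/subvP => x.
rewrite memv_cap memv0 => /andP[xa xc]; apply/eqP.
(* [A c] lies in [A c + A c], so the previous lemma applies with [d = c]. *)
by apply: (peirce2_eq0 ac ac xa); apply: (subvP (addvSl _ _)).
Qed.

Lemma directv_peirce3 (a c d : K) : a != c -> a != d -> c != d ->
  directv (A a + A c + A d).
Proof.
move=> ac ad cd; rewrite directv_addE /= (directv_peirce2 ac) directv_trivial /=.
rewrite -subv0; apply/subvP => x; rewrite memv_cap memv0 => /andP[xac xd].
by apply/eqP; apply: (peirce2_eq0 _ _ xd xac); rewrite eq_sym.
Qed.

(** * Decomposition into eigenvectors from the quadratic relation *)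

(* [L^2 v = (v + s L v) / 2] factors as [(L - s) (L + s / 2) v = 0]. *)
Lemma peirce_root s v : s ^+ 2 = 1 -> L (L v) = 2%:R^-1 *: (v + s *: L v) ->
  L v + (s / 2%:R) *: v \in A s.
Proof.
move=> s2 L2; rewrite mem_peirce linearD linearZ /= L2.
by apply/eqP/ffunP => p; rewrite !algE; field: s2.
Qed.

(** The same factorization with the two commuting factors exchanged. *)
Lemma peirce_root2 s v : s ^+ 2 = 1 -> L (L v) = 2%:R^-1 *: (v + s *: L v) ->
  L v - s *: v \in A (- (s / 2%:R)).
Proof.
move=> s2 L2; rewrite mem_peirce linearB linearZ /= L2.
by apply/eqP/ffunP => p; rewrite !algE; field: s2.
Qed.

Hypothesis three_neq0 : 3%:R != 0 :> K.

Lemma peirce_sum s v : s ^+ 2 = 1 -> L (L v) = 2%:R^-1 *: (v + s *: L v) ->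
  v \in (A s + A (- (s / 2%:R)))%VS.
Proof.
move=> s2 L2.
(* The two eigenvectors differ by [(3 s / 2) v]; since [s^2 = 1], multiplying by [2 s / 3] gives
   back [v]. *)
have -> : v = (2%:R * s / 3%:R) *: (L v + (s / 2%:R) *: v)
            + (- (2%:R * s / 3%:R)) *: (L v - s *: v).
  by apply/ffunP => p; rewrite !algE; field: s2; rewrite three_neq0.
by rewrite memv_add // memvZ ?peirce_root ?peirce_root2.
Qed.

(** Points disjoint from [supp b] lie in the kernel of [L]; on the points of [b] the relation has
    [s = 1], with roots [1] and [-1/2]. *)
Lemma Aplus_sub_peirce : (Aplus K b <= A 1 + A (- 2%:R^-1) + A 0)%VS.
Proof.
apply: Aplus_sub => p pb.
  apply: (subvP (addvSr _ _)).
  by rewrite mem_peirce scale0r L_disjoint.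
apply: (subvP (addvSl _ _)).
have [i [j [k [u sb pE]]]] := point_block pb.
rewrite -[2%:R^-1]mul1r -(edge_ebase pE) peirce_sum ?expr1n // scale1r.
exact: L2_block u sb.
Qed.

(** * The axial condition and homogeneity *)

Definition axial := forall r, r \notin supp b -> kappa delta b r = -1.

(** The elements counted by [n_neg] lie in the complement of [supp b], which has [m - 3] elements;
    equal cardinality means that they fill it. *)
Lemma AxP : b \in Ax delta <-> axial.
Proof.
rewrite inE /n_neg; set S := [set _ | _].
have Sb : S \subset ~: supp b by apply/subsetP => r; rewrite !inE => /andP[].
have <- : #|~: supp b| = (m - 3)%N.
  by rewrite cardsCs setCK card_ord (block_supp b).1.
have -> : (#|S| == #|~: supp b|) = (~: supp b \subset S).
  by rewrite (subset_leqif_card Sb).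
split=> [/subsetP bS r rb|ax].
  by have := bS r; rewrite !inE => /(_ rb)/andP[_ /eqP].
by apply/subsetP => r; rewrite !inE => rb; rewrite rb ax.
Qed.

Lemma Aminus_sub_peirce : axial -> (Aminus K b <= A (- 1) + A 2%:R^-1)%VS.
Proof.
move=> ax; apply: Aminus_sub => p pb.
have [i [j [k [r [u sb pE]]]]] := point_mixed pb.
have rb : r \notin supp b.
  move: u; rewrite sb /= !inE !negb_or !(eq_sym r).
  by move=> /and4P[/and3P[_ _ ->] /andP[_ ->] ->].
(* Here [s = -1], so the second root [- (s / 2)] is [1/2]. *)
have -> : 2%:R^-1 = - (- 1 / 2%:R) :> K by rewrite mulNr opprK mul1r.
rewrite -(edge_ebase pE) peirce_sum ?sqrrN ?expr1n // (L2_mixed u sb) ax //.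
Qed.

(** The odd component of an eigenvector is again an eigenvector for [a], yet it lies in a sum of
    eigenspaces for other eigenvalues, so it vanishes. *)
Lemma peirce_sub_Aplus a : axial -> a != -1 -> a != 2%:R^-1 ->
  (A a <= Aplus K b)%VS.
Proof.
move=> ax a1 a2; apply/subvP => x /peirce_split[y [z [-> yA zA _ za]]].
by rewrite (peirce2_eq0 a1 a2 za) ?addr0 // (subvP (Aminus_sub_peirce ax)).
Qed.

Lemma peirce_sub_Aminus a : a != 1 -> a != - 2%:R^-1 -> a != 0 ->
  (A a <= Aminus K b)%VS.
Proof.
move=> a1 a2 a0; apply/subvP => x /peirce_split[y [z [-> yA zA ya _]]].
by rewrite (peirce3_eq0 a1 a2 a0 ya) ?add0r // (subvP Aplus_sub_peirce).
Qed.

(** If [kappa] is 1 at some [r], then [L + 1/2] applied to [ir] and to [ij] yields nonzero vectors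
    of [A 1] of odd and even degree; neither part can then contain [A 1]. *)
Lemma homogeneous_axial : homogeneous b (A (1 : K)) -> axial.
Proof.
move=> homA r rb; case: (kappa_cases r) => // kr; exfalso.
have [i [j [k [u bE]]]] := block_blk b.
have sb : supp b = [set i; j; k] by rewrite bE supp_blk.
have [ij ik jk] := uniq3P u.
have [ib jb] : i \in supp b /\ j \in supp b by rewrite sb !inE !eqxx ?orbT.
have ur : uniq [:: i; j; k; r].
  move: rb; rewrite sb !inE !negb_or -andbA => /and3P[ri rj rk].
  by rewrite /= !inE !negb_or ij ik jk !(eq_sym _ r) ri rj rk.
have ir : i != r by move: ur; rewrite /= !inE !negb_or => /and4P[/and3P[]].
have jr : j != r by move: ur; rewrite /= !inE !negb_or => /and4P[_ /andP[]].
have kr' : k != r by move: ur; rewrite /= !inE => /and4P[].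
set v := L (edge i r) + (1 / 2%:R) *: edge i r.
set w := L (edge i j) + (1 / 2%:R) *: edge i j.
have v1 : v \in A 1.
  apply: peirce_root; first by rewrite expr1n.
  by rewrite (L2_mixed ur sb) kr.
have w1 : w \in A 1.
  by apply: peirce_root; rewrite ?expr1n // scale1r; apply: L2_block u sb.
have vA : v \in Aminus K b by rewrite memvD ?L_Aminus ?memvZ ?edge_Aminus.
have wA : w \in Aplus K b by rewrite memvD ?L_Aplus ?memvZ ?edge_Aplus.
(* [L] sends [ir] into the span of [jr] and [kr], so the coordinate of [v] at [ir] is [1/2]. *)
have v0 : v != 0.
  apply/eqP => /ffunP/(_ (pt ir)).
  rewrite /v (L_mixed ur sb) !algE !edgeE //= eqxx ffunE.
  have /negPf-> : [set i; r] != [set j; r].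
    by apply/eqP => /setP/(_ i); rewrite !inE eqxx (negPf ij) (negPf ir).
  have /negPf-> : [set i; r] != [set k; r].
    by apply/eqP => /setP/(_ i); rewrite !inE eqxx (negPf ik) (negPf ir).
  rewrite !mulr0 addr0 mulr0 add0r mulr1 mul1r => /eqP.
  by rewrite invr_eq0 (negPf two_neq0).
have w0 : w != 0.
  apply/eqP => /ffunP/(_ (pt ij)).
  rewrite /w (L_block u sb) !algE !edgeE //= eqxx ffunE.
  have /negPf-> : [set i; j] != [set i; k].
    by apply/eqP => /setP/(_ j); rewrite !inE eqxx orbT eq_sym (negPf ij) (negPf jk).
  have /negPf-> : [set i; j] != [set j; k].
    by apply/eqP => /setP/(_ i); rewrite !inE eqxx (negPf ij) (negPf ik).
  rewrite addr0 mulr0 add0r mulr1 mul1r => /eqP.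
  by rewrite invr_eq0 (negPf two_neq0).
case/orP: homA => /subvP sA.
  by rewrite (Aplus_Aminus0 (sA _ v1) vA) eqxx in v0.
by rewrite (Aplus_Aminus0 wA (sA _ w1)) eqxx in w0.
Qed.

End Peirce.

(** * Assembly in characteristic 0 *)

Theorem theorem4p2 (K : fieldType) (charK0 : [pchar K] =i pred0)
    (m : nat) (m_ge3 : (3 <= m)%N) (delta : decoration m) (b : block m) :
  let A (a : K) : {vspace alg K m} := peirce delta b a in
  ((forall a : K, homogeneous b (A a)) <-> b \in Ax delta) /\
  (b \in Ax delta ->
    [/\ Aplus K b = (A 1%R + A (- 2%:R^-1)%R + A 0%R)%VS,
        directv (A 1%R + A (- 2%:R^-1)%R + A 0%R),
        Aminus K b = (A (- 1)%R + A (2%:R^-1)%R)%VS,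
        directv (A (- 1)%R + A (2%:R^-1)%R)
      & (forall x : alg K m, x \in Aplus K b -> theta K b x = x) /\
        (forall x : alg K m, x \in Aminus K b -> theta K b x = - x)]).
Proof.
move=> A.
have two0 : 2%:R != 0 :> K by rewrite ((pcharf0P K).1 charK0).
have three0 : 3%:R != 0 :> K by rewrite ((pcharf0P K).1 charK0).
(* Two scalars are shown distinct by exhibiting the inverse [t] of their difference. *)
have neq (t a c : K) : t * (a - c) = 1 -> a != c.
  by apply: contra_eq_neq => ->; rewrite subrr mulr0 eq_sym oner_neq0.
have n1_1 : 1 != -1 :> K by apply: (neq 2%:R^-1); field.
have n1_h : 1 != 2%:R^-1 :> K by apply: (neq 2%:R); field.
have nh_1 : - 2%:R^-1 != -1 :> K by apply: (neq 2%:R); field.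
have nh_h : - 2%:R^-1 != 2%:R^-1 :> K by apply: (neq (-1)); field.
have n0_1 : 0 != -1 :> K by apply: (neq 1); field.
have n0_h : 0 != 2%:R^-1 :> K by apply: (neq (- 2%:R)); field.
have n1h : 1 != - 2%:R^-1 :> K by apply: (neq (2%:R / 3%:R)); field; rewrite two0.
have n10 : 1 != 0 :> K by apply: oner_neq0.
have nh0 : - 2%:R^-1 != 0 :> K by apply: (neq (- 2%:R)); field.
have n_1h : -1 != 2%:R^-1 :> K by apply: (neq (- 2%:R / 3%:R)); field; rewrite two0.
split; last move=> /AxP ax; first split=> [hom|/AxP ax a].
- exact/AxP/(homogeneous_axial two0 (hom 1)).
(* Only [-1] and [1/2] can have odd eigenvectors; for every other [a], eigenvalue or not, [A a] is
   contained in the even part. *)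
- apply/orP; have [->|a1] := eqVneq a (-1); last have [->|a2] := eqVneq a 2%:R^-1.
  + by right; apply: peirce_sub_Aminus; rewrite // eq_sym.
  + by right; apply: peirce_sub_Aminus; rewrite // eq_sym.
  by left; apply: peirce_sub_Aplus.
split.
(* One inclusion decomposes basis vectors; the other is homogeneity of each summand. *)
- apply: subv_anti; rewrite Aplus_sub_peirce // !subv_add.
  by rewrite /= -andbA; apply/and3P; split; apply: peirce_sub_Aplus.
- exact: directv_peirce3.
- apply: subv_anti; rewrite Aminus_sub_peirce // subv_add.
  by rewrite /=; apply/andP; split; apply: peirce_sub_Aminus; rewrite // eq_sym.
- exact: directv_peirce2.
by split=> x; [apply: theta_Aplus|apply: theta_Aminus].
Qed.
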